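(* Let $t$ and $p$ be positive integers, and write $t=pn+d$ with integers $n\geq 0$ and $1\leq d\leq p$. Then the largest size of a $(t,t+1,\ldots,t+p)$-core partition is \[ \max\Big\{\tbinom{n+2}{2}\lfloor\tfrac{d}{2}\rfloor\big(d-\lfloor\tfrac{d}{2}\rfloor\big)+\tbinom{n+2}{3}(p^2n+pd-p^2)-3\tbinom{n+2}{4}p^2,\; \tbinom{n+1}{2}\big(p-\lfloor\tfrac{p-d}{2}\rfloor\big)\big(d+\lfloor\tfrac{p-d}{2}\rfloor\big)+\tbinom{n+1}{3}(p^2n+pd-p^2)-3\tbinom{n+1}{4}p^2\Big\}. \] Moreover, the number of $(t,t+1,\ldots,t+p)$-core partitions attaining this largest size is at most $4$.
   Context: A partition is a finite weakly decreasing sequence $\lambda=(\lambda_1,\ldots,\lambda_r)$ of positive integers (the empty partition is allowed); its size is $|\lambda|=\sum_i\lambda_i$. In the Young diagram of $\lambda$ (row $i$ has $\lambda_i$ left-justified boxes), the hook length $h(i,j)$ of box $(i,j)$ is the number of boxes directly to its right, directly below it, plus the box itself. For a positive integer $t$, $\lambda$ is a $t$-core partition if none of its hook lengths is divisible by $t$; it is a $(t_1,\ldots,t_m)$-core partition if it is a $t_i$-core for every $i$. Binomial coefficients $\binom{a}{b}$ are $0$ when $a<b$; $\lfloor x\rfloor$ is the floor of $x$. *)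

(* Defs.v *)
From HB Require Import structures.
From mathcomp Require Import all_boot all_order all_algebra.

Set Implicit Arguments.
Unset Strict Implicit.
Unset Printing Implicit Defensive.

Definition is_partition (la : seq nat) : bool :=
  sorted geq la && all (fun x => 0 < x) la.

(* Rows and columns are numbered from 0, so (i, j) is a box of the Young
   diagram of la when i < size la and j < nth 0 la i.  The three summands are
   the boxes to the right, the boxes below, and the box itself. *)
Definition hook (la : seq nat) (i j : nat) : nat :=
  (nth 0 la i - j.+1) + count (fun x => j < x) (drop i.+1 la) + 1.

Definition is_core (t : nat) (la : seq nat) : Prop :=
  forall i j, i < size la -> j < nth 0 la i -> ~~ (t %| hook la i j).

Definition is_core_partition (ts : seq nat) (la : seq nat) : Prop :=
  is_partition la /\ (forall t, t \in ts -> is_core t la).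

Import GRing.Theory Num.Theory.
Local Open Scope ring_scope.

(* The formula is stated in int because p^2 n + p d - p^2 is negative
   for n = 0 and d < p. *)
Definition max_size1 (p n d : nat) : int :=
  'C(n + 2, 2)%:Z * (d %/ 2)%N%:Z * (d%:Z - (d %/ 2)%N%:Z)
  + 'C(n + 2, 3)%:Z * (p%:Z ^+ 2 * n%:Z + p%:Z * d%:Z - p%:Z ^+ 2)
  - 3 * 'C(n + 2, 4)%:Z * p%:Z ^+ 2.

(* For d <= p the truncated difference p - d is exact. *)
Definition max_size2 (p n d : nat) : int :=
  'C(n + 1, 2)%:Z * (p%:Z - ((p - d) %/ 2)%N%:Z) * (d%:Z + ((p - d) %/ 2)%N%:Z)
  + 'C(n + 1, 3)%:Z * (p%:Z ^+ 2 * n%:Z + p%:Z * d%:Z - p%:Z ^+ 2)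
  - 3 * 'C(n + 1, 4)%:Z * p%:Z ^+ 2.

(* Main.v *)
Require Import Defs.
From mathcomp Require Import all_boot all_order all_algebra zify ring.

(* The first-column hook lengths of a partition form its beta set X, and the
   partition is an s-core iff x - s stays in X for every x in X with s <= x.
   For a (t, ..., t + p)-core, X avoids the semigroup generated by t, ...,
   t + p, so X splits into rows, the k-th one inside the interval
   [k (t + p), (k + 1) t[, and the row sizes a_k satisfy
   a_(k+1) <= max(a_k - p, 0).  Pushing each row to the right end of its
   interval keeps these conditions and can only increase the size, so that
   only the sequence a matters.  If a_(k+1) < a_k - p, then either adding one
   element to row k + 1 or removing one from row k strictly increases the
   size, hence the best sequences are the staircases a_k = max(c - p k, 0)
   with c < t.  For c = p q + r with 0 <= r < p, going from c to c + 1 adds one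
   element to each of the rows 0, ..., q and changes the size by
   C(q+2, 2) (t - p q - 2 r - 1).  This is positive for q < n - 1, and in each
   of the blocks q = n - 1 and q = n the size is a concave parabola in r with at
   most two maximisers. *)

Set Implicit Arguments.
Unset Strict Implicit.
Unset Printing Implicit Defensive.

Import GRing.Theory Num.Theory Order.TTheory.

Lemma geq_trans : transitive geq.
Proof. exact: rev_trans leq_trans. Qed.

Lemma gtn_trans : transitive gtn.
Proof. exact: rev_trans ltn_trans. Qed.

Lemma gtn_sorted_uniq (s : seq nat) : sorted gtn s -> uniq s.
Proof. by rewrite gtn_sorted_uniq_geq => /andP[]. Qed.

Lemma gtn_sorted_rev_iota m n : sorted gtn (rev (iota m n)).
Proof. by rewrite rev_sorted iota_ltn_sorted. Qed.

Lemma gtn_sorted_eq (s1 s2 : seq nat) :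
  sorted gtn s1 -> sorted gtn s2 -> s1 =i s2 -> s1 = s2.
Proof. exact: irr_sorted_eq gtn_trans ltnn _ _. Qed.

Lemma gtn_path_size x (s : seq nat) : path gtn x s -> size s <= x.
Proof. by elim: s x => //= y s IH x /andP[lt_yx /IH/leq_ltn_trans-> //]. Qed.

Lemma rev_iotaS m n : rev (iota m n.+1) = m + n :: rev (iota m n).
Proof. by rewrite -addn1 iotaD rev_cat. Qed.

Lemma leqif_sumn_rev_iota N (s : seq nat) :
    sorted gtn s -> {in s, forall x, x < N} ->
  sumn s + 'C((size s).+1, 2) <= size s * N
    ?= iff (s == rev (iota (N - size s) (size s))).
Proof.
elim: s N => [|x s IH] N /= path_s lt_N; first by split; rewrite ?eqxx.
have lt_xN : x < N by apply: lt_N; rewrite mem_head.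
have lt_s : {in s, forall y, y < x}.
  exact/allP/(order_path_min gtn_trans path_s).
have -> : x + sumn s + 'C((size s).+2, 2)
    = x.+1 + size s + (sumn s + 'C((size s).+1, 2)) by rewrite binS bin1; lia.
have -> : (x :: s == rev (iota (N - (size s).+1) (size s).+1))
    = (s == rev (iota (x - size s) (size s))) && (x.+1 == N).
  have le_sx := gtn_path_size path_s; rewrite rev_iotaS eqseq_cons andbC.
  rewrite (_ : (x == N - (size s).+1 + size s) = (x.+1 == N)); last by lia.
  by case: (x.+1 =P N) => [<-|]; rewrite ?andbF ?andbT.
apply: leqif_trans (_ : (size s).+1 * x.+1 <= _ ?= iff _).
  rewrite (_ : (size s).+1 * x.+1 = x.+1 + size s + size s * x); last by ring.
  by have := IH x (path_sorted path_s) lt_s; rewrite /leqif leq_add2l eqn_add2l.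
by apply/leqifP; case: eqP => [->|]; rewrite // ltn_mul2l /=; lia.
Qed.

Fixpoint beta_set (la : seq nat) : seq nat :=
  if la is l :: la' then l + size la' :: beta_set la' else [::].

Fixpoint partition_of_beta (X : seq nat) : seq nat :=
  if X is x :: X' then x - size X' :: partition_of_beta X' else [::].

Lemma size_beta_set la : size (beta_set la) = size la.
Proof. by elim: la => //= l la ->. Qed.

Lemma size_partition_of_beta X : size (partition_of_beta X) = size X.
Proof. by elim: X => //= x X ->. Qed.

Lemma sumn_beta_set la : sumn (beta_set la) = sumn la + 'C(size la, 2).
Proof. by elim: la => //= l la ->; rewrite binS bin1; lia. Qed.

Lemma beta_set_inj : injective beta_set.
Proof.
elim=> [|l la IH] [|m mu] //= [eq_lm /[dup] /IH eq_la _].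
by move: eq_lm; rewrite eq_la => /addIn ->.
Qed.

Lemma partition_of_betaK X : sorted gtn X -> beta_set (partition_of_beta X) = X.
Proof.
elim: X => //= x X IH path_X; rewrite IH ?(path_sorted path_X) //.
by rewrite size_partition_of_beta subnK // gtn_path_size.
Qed.

Lemma sorted_beta_set la : sorted gtn (beta_set la) = sorted geq la.
Proof.
by elim: la => [|l [|m la] /= IH] //=; rewrite -IH /= addnS ltnS leq_add2r.
Qed.

Lemma is_partition_beta_set la :
  is_partition la = sorted gtn (beta_set la) && (0 \notin beta_set la).
Proof.
rewrite /is_partition sorted_beta_set; apply: andb_id2l.
elim: la => [|l [|m la] IH] //=; first by rewrite inE; lia.
move=> /andP[/= le_ml /IH IH_la]; rewrite [in RHS]inE negb_or -IH_la /=.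
by case: (ltnP 0 m) => m_gt0; rewrite ?andbF //; congr (_ && _); lia.
Qed.

Lemma nth_geq_path l la i : path geq l la -> nth 0 la i <= l.
Proof.
move=> path_la; have [lt_i|?] := ltnP i (size la); last by rewrite nth_default.
by have /allP := order_path_min geq_trans path_la; apply; apply: mem_nth.
Qed.

(* Along the boundary of the diagram, read from the bottom left, beta_set la
   lists the positions of the vertical steps and beta_gap la j is the position
   of the horizontal step in column j. *)
Definition beta_gap (la : seq nat) (j : nat) : nat :=
  j + count (fun x => x <= j) la.

Lemma count_leq_gtn j la :
  count (fun x => x <= j) la + count (fun x => j < x) la = size la.
Proof.
rewrite -(count_predC (fun x => x <= j)); congr (_ + _).
by apply: eq_count => x /=; rewrite ltnNge.
Qed.

Lemma count_leq_path l la j : path geq l la -> l <= j ->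
  count (fun x => x <= j) la = size la.
Proof.
move=> path_la le_lj; apply/eqP; rewrite -all_count.
apply: sub_all (order_path_min geq_trans path_la) => x /= le_xl.
exact: leq_trans le_lj.
Qed.

Lemma leq_beta_gap la i j : sorted geq la -> i < size la ->
  (beta_gap la j <= nth 0 (beta_set la) i) = (j < nth 0 la i).
Proof.
rewrite /beta_gap; elim: la i => [|l la IH] [|i] //= path_la lt_i.
  have [le_lj|lt_jl] := leqP l j.
    by rewrite (count_leq_path path_la); lia.
  by have := count_leq_gtn j la; lia.
have le_l := nth_geq_path i path_la; have := IH i (path_sorted path_la) lt_i.
by have [le_lj|//] := leqP l j; lia.
Qed.

Lemma hook_beta_set la i j : sorted geq la -> i < size la -> j < nth 0 la i ->
  hook la i j + beta_gap la j = nth 0 (beta_set la) i.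
Proof.
rewrite /hook /beta_gap; elim: la i => [|l la IH] [|i] //= path_la lt_i lt_j.
  by rewrite drop0; have := count_leq_gtn j la; lia.
rewrite -IH ?(path_sorted path_la) //.
by have := nth_geq_path i path_la; lia.
Qed.

Lemma beta_gapP la y : sorted geq la ->
  reflect (exists j, y = beta_gap la j) (y \notin beta_set la).
Proof.
move=> sorted_la; apply: (iffP idP) => [|[j ->]]; last first.
  apply/negP => /(nthP 0)[i]; rewrite size_beta_set => lt_i eq_gap.
  have := leq_beta_gap j sorted_la lt_i; rewrite eq_gap leqnn => /esym lt_j.
  by have := hook_beta_set sorted_la lt_i lt_j; rewrite eq_gap /hook; lia.
rewrite /beta_gap; elim: la y sorted_la => [|l la IH] y /=.
  by exists y; rewrite addn0.
move=> path_la; rewrite inE negb_or => /andP[ne_y].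
move=> /(IH y (path_sorted path_la))[j def_y].
have [lt_jl|le_lj] := ltnP j l; first by exists j; rewrite leqNgt lt_jl.
have count_la k : l <= k -> _ := @count_leq_path l la k path_la.
rewrite def_y count_la // in ne_y *.
by exists j.-1; rewrite count_la; lia.
Qed.

Lemma is_core_beta_set t la : sorted geq la ->
  is_core t la <->
  {in beta_set la,
    forall x y, y < x -> y \notin beta_set la -> ~~ (t %| x - y)}.
Proof.
move=> sorted_la; split=> [core_la x /(nthP 0)[i] | core_la i j lt_i lt_j].
  rewrite size_beta_set => lt_i <- y lt_y /(beta_gapP _ sorted_la)[j def_y].
  have lt_j : j < nth 0 la i by rewrite -leq_beta_gap // -def_y ltnW.
  by rewrite def_y -(hook_beta_set sorted_la lt_i lt_j) addnK core_la.
have hookE := hook_beta_set sorted_la lt_i lt_j.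
rewrite -(addnK (beta_gap la j) (hook la i j)) hookE; apply: core_la.
- by rewrite mem_nth // size_beta_set.
- by rewrite -hookE /hook; lia.
by apply/beta_gapP => //; exists j.
Qed.

Definition subn_closed (t : nat) (X : seq nat) : Prop :=
  {in X, forall x, t <= x -> x - t \in X}.

Lemma subn_closed_mul t X x q : subn_closed t X ->
  x \in X -> q * t <= x -> x - q * t \in X.
Proof.
move=> closed_X x_X; elim: q => [|q IH] le_x; first by rewrite subn0.
by rewrite mulSnr subnDA closed_X ?IH; lia.
Qed.

Lemma is_core_subn_closed t la : 0 < t -> sorted geq la ->
  is_core t la <-> subn_closed t (beta_set la).
Proof.
move=> t_gt0 sorted_la; rewrite is_core_beta_set //.
split=> [core_la x x_la le_tx | closed_la x x_la y lt_yx].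
  apply: contraT => xt_notin_la; have lt_x : x - t < x by lia.
  by have := core_la x x_la _ lt_x xt_notin_la; rewrite subKn ?dvdnn.
apply: contra => /dvdnP[q eq_xy].
by rewrite (_ : y = x - q * t) ?subn_closed_mul //; lia.
Qed.

Definition core_beta_set (ts X : seq nat) : Prop :=
  [/\ sorted gtn X, 0 \notin X & {in ts, forall t, subn_closed t X}].

Lemma is_core_partition_beta_set ts la : 0 \notin ts ->
  is_core_partition ts la <-> core_beta_set ts (beta_set la).
Proof.
move=> ts_neq0; rewrite /is_core_partition is_partition_beta_set.
have core_iff t : t \in ts -> sorted gtn (beta_set la) ->
    is_core t la <-> subn_closed t (beta_set la).
  rewrite sorted_beta_set => t_ts; apply: is_core_subn_closed.
  by rewrite lt0n; apply: contraNneq ts_neq0 => <-.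
split=> [[/andP[sorted_la la_neq0] core_la]|[sorted_la la_neq0 closed_la]].
  by split=> // t t_ts; apply/core_iff => //; apply: core_la.
by rewrite sorted_la; split=> // t t_ts; apply/core_iff => //; apply: closed_la.
Qed.

Definition profile (t p : nat) (a : nat -> nat) : Prop :=
  a 0 < t /\ forall k, a k.+1 <= a k - p.

(* For a profile a, the size of the partition whose beta set consists, for each
   k < m, of the a k integers just below k.+1 * t. *)
Definition profile_size (t m : nat) (a : nat -> nat) : int :=
  ((\sum_(k < m) a k * (k.+1 * t))%N%:Z
   - (\sum_(k < m) 'C((a k).+1, 2) + 'C(\sum_(k < m) a k, 2))%N%:Z)%R.

Definition staircase (p c k : nat) : nat := c - p * k.

Lemma eq_profile_size t m a a' : (forall k, k < m -> a k = a' k) ->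
  profile_size t m a = profile_size t m a'.
Proof.
move=> eq_a; rewrite /profile_size.
have eq_sum F : \sum_(k < m) F k (a k) = \sum_(k < m) F k (a' k) :> nat.
  by apply: eq_bigr => k _; rewrite eq_a.
by rewrite (eq_sum (fun k x => x * (k.+1 * t))) (eq_sum (fun=> id))
  (eq_sum (fun _ x => 'C(x.+1, 2))).
Qed.

Lemma bin2D u v : 'C(u + v, 2) = 'C(u, 2) + u * v + 'C(v, 2).
Proof.
elim: v => [|v IH]; first by rewrite muln0 !addn0.
by rewrite addnS !(binS _ 1) IH !bin1 mulnS; lia.
Qed.

Lemma sum_addb m (a : nat -> nat) (B : pred nat) (F : nat -> nat -> nat) G :
    (forall k, F k (a k).+1 = F k (a k) + G k) ->
  \sum_(k < m) F k (a k + B k)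
  = \sum_(k < m) F k (a k) + \sum_(k < m | B k) G k.
Proof.
move=> FS; rewrite [X in _ = _ + X]big_mkcond -big_split.
by apply: eq_bigr => k _ /=; case: (B k); rewrite ?addn1 ?addn0.
Qed.

Lemma profile_size_addb t m (a : nat -> nat) (B : pred nat) :
  let N := \sum_(k < m | B k) 1 in
  (profile_size t m (fun k => a k + B k)%N = profile_size t m a
   + ((\sum_(k < m | B k) k.+1 * t)%N%:Z - (\sum_(k < m | B k) (a k).+1
      + (\sum_(k < m) a k) * N + 'C(N, 2))%N%:Z))%R.
Proof.
move=> N; rewrite /profile_size.
rewrite (@sum_addb m a B (fun=> id) (fun=> 1)) => [|k]; last by rewrite addn1.
rewrite (@sum_addb m a B (fun k x => x * (k.+1 * t)) (fun k => k.+1 * t))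
  => [|k]; last by rewrite mulSnr.
rewrite (@sum_addb m a B (fun _ x => 'C(x.+1, 2)) (fun k => (a k).+1))
  => [|k]; last by rewrite binS bin1.
by rewrite -/N bin2D; lia.
Qed.

Lemma profile_size_incr_row t m (a : nat -> nat) k : k < m ->
  (profile_size t m (fun i => a i + (i == k))%N = profile_size t m a
   + ((k.+1 * t)%:Z - ((a k).+1 + \sum_(i < m) a i)%N%:Z))%R.
Proof.
move=> lt_km; have /= -> := profile_size_addb t m a (pred1 k).
by rewrite (big_ord1_eq _ (fun=> 1)) (big_ord1_eq _ (fun i => i.+1 * t))
  (big_ord1_eq _ (fun i => (a i).+1)) lt_km muln1 addn0.
Qed.

Lemma profile_le_staircase t p a k :
  profile t p a -> a k <= staircase p (a 0) k.
Proof.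
rewrite /staircase => -[_ aS]; elim: k => [|k IH]; first by rewrite muln0 subn0.
by have := aS k; rewrite mulnS; lia.
Qed.

Lemma profile_staircase t p c : c < t -> profile t p (staircase p c).
Proof. by move=> lt_ct; split=> [|k]; rewrite /staircase ?mulnS; lia. Qed.

(* The gains from increasing a k.+1 and from decreasing a k add up to
   t - 2 + a k - a k.+1 > 0. *)
Lemma profile_size_improve t p m a k : 0 < p -> profile t p a ->
  a k.+1 < a k - p -> k.+1 < m ->
  exists2 a', profile t p a' & (profile_size t m a < profile_size t m a')%R.
Proof.
move=> p_gt0 [a0 aS] defect lt_km; have lt_k := ltnW lt_km.
pose up i := a i + (i == k.+1); pose down i := a i - (i == k).
have down_up i : down i + (i == k) = a i.
  by rewrite /down; case: eqP => [->|]; lia.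
have sum_a : \sum_(i < m) a i = (\sum_(i < m) down i).+1.
  have := @sum_addb m down (pred1 k) (fun=> id) (fun=> 1).
  rewrite (big_ord1_eq _ (fun=> 1)) lt_k addn1 /= => <- => [|i].
    exact: eq_bigr.
  by rewrite addn1.
have size_up := profile_size_incr_row t a lt_km.
have size_down := profile_size_incr_row t down lt_k.
rewrite (eq_profile_size t (fun i _ => down_up i)) in size_down.
have [gain|loss] := ltP (profile_size t m a) (profile_size t m up).
  exists up => //; split=> [|i]; rewrite /up ?addn0 // eqSS.
  by have := aS i; case: (i =P k) => [->|]; rewrite ?(gtn_eqF (ltnSn k)); lia.
exists down; last first.
  have down_k : down k = (a k).-1 by rewrite /down eqxx subn1.
  by move: loss; rewrite size_up size_down sum_a down_k mulSn; lia.
split=> [|i]; first exact: leq_ltn_trans (leq_subr _ _) a0.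
by have := aS i; rewrite /down; case: (i =P k) => [->|]; lia.
Qed.

Lemma profile_size_le t p m a : profile t p a ->
  (profile_size t m a <= (\sum_(k < m) t * (k.+1 * t))%N%:Z)%R.
Proof.
move=> prof_a.
apply: le_trans (_ : (\sum_(k < m) a k * (k.+1 * t))%N%:Z <= _)%R.
  by rewrite /profile_size; lia.
rewrite lez_nat; apply: leq_sum => k _; rewrite leq_mul2r.
have [a0 _] := prof_a; have := profile_le_staircase k prof_a.
by rewrite /staircase; lia.
Qed.

Lemma profile_staircase_or_lt t p m a : 0 < p -> profile t p a ->
  (forall k, k < m -> a k = staircase p (a 0) k) \/
  exists2 c, c < t & (profile_size t m a < profile_size t m (staircase p c))%R.
Proof.
move=> p_gt0; pose bound := \sum_(k < m) t * (k.+1 * t).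
have [N] := ubnP `|(bound%:Z - profile_size t m a)%R|%N.
elim: N a => // N IH a lt_N prof_a; have [a0 aS] := prof_a.
have [/existsP[k /andP[lt_km defect]]|no_defect] :=
    boolP [exists k : 'I_m, (k.+1 < m) && (a k.+1 < a k - p)].
  have [a' prof_a' gain] := profile_size_improve p_gt0 prof_a defect lt_km.
  have le_bound : (profile_size t m a' <= bound%:Z)%R.
    exact: profile_size_le prof_a'.
  right; have [|eq_a'|[c lt_ct gain']] := IH a' _ prof_a'; first by lia.
    by exists (a' 0); [case: prof_a' | rewrite -(eq_profile_size t eq_a')].
  by exists c => //; apply: lt_trans gain gain'.
left; elim=> [|k IHk] lt_km; first by rewrite /staircase muln0 subn0.
move/existsPn/(_ (Ordinal (ltnW lt_km))): no_defect => /=.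
have := aS k; rewrite lt_km IHk ?(ltnW lt_km) // /staircase mulnS; lia.
Qed.

Definition row (T k : nat) (X : seq nat) : seq nat :=
  [seq x <- X | x %/ T == k].

Definition right_row (t k a : nat) : seq nat := rev (iota (k.+1 * t - a) a).

Lemma size_right_row t k a : size (right_row t k a) = a.
Proof. by rewrite size_rev size_iota. Qed.

Lemma sorted_row T k X : sorted gtn X -> sorted gtn (row T k X).
Proof. exact: sorted_filter gtn_trans _ _. Qed.

Lemma mem_row T k X x : 0 < T ->
  (x \in row T k X) = (k * T <= x < k.+1 * T) && (x \in X).
Proof.
move=> T_gt0; rewrite mem_filter; congr (_ && _).
by rewrite eqn_leq leq_divRL // -ltnS ltn_divLR // andbC.
Qed.

Lemma sum_rows T m (X : seq nat) (F : nat -> nat) :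
  {in X, forall x, x %/ T < m} ->
  \sum_(x <- X) F x = \sum_(k < m) \sum_(x <- row T k X) F x.
Proof.
move=> lt_row; under [RHS]eq_bigr do rewrite big_filter.
rewrite (exchange_big_dep xpredT) //= big_seq [RHS]big_seq.
by apply: eq_bigr => x x_X; rewrite (big_pred1 (Ordinal (lt_row x x_X))).
Qed.

Lemma leq_size_addn_interval p x (s Y : seq nat) : path gtn x s ->
    (forall y i, y \in x :: s -> i <= p -> y + i \in Y) ->
  size (x :: s) + p <= size Y.
Proof.
move=> path_s sub_Y; have lt_s := allP (order_path_min gtn_trans path_s).
rewrite -(size_iota x.+1 p) -size_cat; apply: uniq_leq_size => [|y].
  rewrite cat_uniq iota_uniq (gtn_sorted_uniq (s := x :: s)) // andbT.
  apply/hasPn => y; rewrite mem_iota => /andP[lt_xy _].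
  by apply/negP; rewrite inE => /predU1P[|/lt_s /=]; lia.
rewrite mem_cat => /orP[y_s|]; first by rewrite -(addn0 y) sub_Y.
rewrite mem_iota => /andP[lt_xy le_y].
by rewrite -(subnKC (ltnW lt_xy)) sub_Y ?mem_head //; lia.
Qed.

Section IntervalCores.

Variables t p : nat.
Hypothesis t_gt0 : 0 < t.
Local Notation ts := (iota t p.+1).
Local Notation T := (t + p).

Let T_gt0 : 0 < T. Proof. by rewrite addn_gt0 t_gt0. Qed.

Lemma core_beta_set_subn X x i : core_beta_set ts X ->
  x \in X -> i <= p -> t + i <= x -> x - (t + i) \in X.
Proof.
move=> [_ _ closed_X] x_X le_ip; apply: closed_X => //.
by rewrite mem_iota; lia.
Qed.

Lemma core_beta_set_semigroup X k i : core_beta_set ts X ->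
  i <= k * p -> k * t + i \notin X.
Proof.
move=> core_X; have [_ X_neq0 _] := core_X; elim: k i => [|k IH] i.
  by rewrite mul0n leqn0 => /eqP ->.
rewrite !mulSn => le_i; apply/negP => /(core_beta_set_subn core_X).
move/(_ (minn i p) (geq_minr _ _)).
have -> : t + k * t + i - (t + minn i p) = k * t + (i - minn i p) by lia.
by rewrite (negPf (IH _ _)); lia.
Qed.

Lemma core_row_lt X k x : core_beta_set ts X -> x \in row T k X -> x < k.+1 * t.
Proof.
rewrite mem_row // => core_X /andP[/andP[_ lt_x] x_X].
rewrite ltnNge; apply/negP => le_x; rewrite mulnDr in lt_x.
have le_i : x - k.+1 * t <= k.+1 * p by lia.
by have := core_beta_set_semigroup core_X le_i; rewrite subnKC // x_X.
Qed.

Lemma core_row_index_lt m X x : t <= p * m -> core_beta_set ts X ->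
  x \in X -> x %/ T < m.
Proof.
move=> le_t core_X x_X.
have : x < (x %/ T).+1 * t.
  by apply: core_row_lt core_X _; rewrite mem_filter eqxx.
have := leq_divM x T; rewrite mulnDr mulSn => le_x lt_x.
have : x %/ T * p < m * p by rewrite (mulnC m); lia.
by rewrite ltn_mul2r => /andP[].
Qed.

Definition row_sizes (X : seq nat) (k : nat) : nat := size (row T k X).

Lemma row_sizes_leq X k : core_beta_set ts X ->
  row_sizes X k.+1 <= row_sizes X k - p.
Proof.
rewrite /row_sizes => core_X; have [sorted_X _ _] := core_X.
case def_row: (row T k.+1 X) => [//|x s].
suff: size (x :: s) + p <= size [seq z + T | z <- row T k X].
  by rewrite size_map /=; lia.
apply: leq_size_addn_interval => [|y i].
  by have := sorted_row T k.+1 sorted_X; rewrite def_row.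
rewrite -def_row => y_row le_ip; have := core_row_lt core_X y_row.
move: y_row; rewrite mem_row // !mulSn => /andP[/andP[le_y _] y_X] lt_y.
apply/mapP; exists (y + i - T); last by lia.
rewrite mem_row // (_ : y + i - T = y - (t + (p - i))); last by lia.
by rewrite core_beta_set_subn // ?leq_subr ?mulSn; lia.
Qed.

Lemma profile_row_sizes X :
  core_beta_set ts X -> profile t p (row_sizes X).
Proof.
move=> core_X; split=> [|k]; last exact: row_sizes_leq.
have [sorted_X X_neq0 _] := core_X.
suff : row_sizes X 0 <= size (iota 1 t.-1) by rewrite size_iota; lia.
apply: uniq_leq_size => [|x x_row]; first exact/gtn_sorted_uniq/sorted_row.
have := core_row_lt core_X x_row; rewrite mem_iota mul1n add1n prednK // => ->.
move: x_row; rewrite mem_filter lt0n andbT => /andP[_].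
by apply: contraTneq => ->.
Qed.

Lemma leif_sumn_core la m : t <= p * m -> core_beta_set ts (beta_set la) ->
  let X := beta_set la in
  ((sumn la)%:Z <= profile_size t m (row_sizes X)
    ?= iff [forall k : 'I_m, row T k X == right_row t k (row_sizes X k)])%R.
Proof.
move=> le_t core_X X; have [sorted_X _ _] := core_X.
have lt_m : {in X, forall x, x %/ T < m} by move=> x; apply: core_row_index_lt.
have sum_size : \sum_(k < m) row_sizes X k = size la.
  rewrite -size_beta_set -sum1_size (sum_rows _ lt_m).
  by apply: eq_bigr => k _; rewrite sum1_size.
have sum_sumn : \sum_(k < m) sumn (row T k X) = sumn la + 'C(size la, 2).
  rewrite -sumn_beta_set sumnE (sum_rows _ lt_m).
  by apply: eq_bigr => k _; rewrite sumnE.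
have [] : \sum_(k < m) (sumn (row T k X) + 'C((row_sizes X k).+1, 2))
    <= \sum_(k < m) row_sizes X k * (k.+1 * t)
    ?= iff [forall k : 'I_m, row T k X == right_row t k (row_sizes X k)].
  apply: leqif_sum => k _; apply: leqif_sumn_rev_iota; first exact: sorted_row.
  by move=> x; apply: core_row_lt.
rewrite big_split /= sum_sumn /profile_size sum_size.
move: (\sum_(k < m) row_sizes X k * _) (\sum_(k < m) 'C(_, 2)) => A B.
by move=> le_sum eq_sum; split; [|rewrite -eq_sum]; lia.
Qed.

Lemma core_beta_set_eq_rows m X Y : t <= p * m ->
    core_beta_set ts X -> core_beta_set ts Y ->
  (forall k, k < m -> row T k X = row T k Y) -> X = Y.
Proof.
move=> le_t core_X core_Y eq_row.
have [[sorted_X _ _] [sorted_Y _ _]] := (core_X, core_Y).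
apply: gtn_sorted_eq => // x.
have mem_rowE Z : (x \in Z) = (x \in row T (x %/ T) Z).
  by rewrite mem_filter eqxx.
apply/idP/idP => x_in; rewrite mem_rowE.
  by rewrite -eq_row -?mem_rowE // (core_row_index_lt le_t core_X).
by rewrite eq_row -?mem_rowE // (core_row_index_lt le_t core_Y).
Qed.

Definition beta_of_profile (m : nat) (a : nat -> nat) : seq nat :=
  [seq x <- rev (iota 0 (m * T))
     | let k := x %/ T in (k.+1 * t <= x + a k) && (x < k.+1 * t)].

Lemma sorted_beta_of_profile m a : sorted gtn (beta_of_profile m a).
Proof. exact/(sorted_filter gtn_trans)/gtn_sorted_rev_iota. Qed.

Lemma mem_beta_of_profile m a x k : k * T <= x < k.+1 * T -> k < m ->
  (x \in beta_of_profile m a) = (k.+1 * t <= x + a k) && (x < k.+1 * t).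
Proof.
move=> /andP[le_x lt_x] lt_km; rewrite mem_filter mem_rev mem_iota /= add0n.
have -> : x %/ T = k.
  by apply/eqP; rewrite eqn_leq leq_divRL // le_x -ltnS ltn_divLR // lt_x.
by rewrite andbC (leq_trans lt_x) // leq_mul2r lt_km orbT.
Qed.

Lemma row_beta_of_profile m a k : profile t p a -> k < m ->
  row T k (beta_of_profile m a) = right_row t k (a k).
Proof.
move=> prof_a lt_km; have [a0 _] := prof_a.
have le_a := profile_le_staircase k prof_a; rewrite /staircase in le_a.
apply: gtn_sorted_eq; rewrite ?gtn_sorted_rev_iota //.
  exact/sorted_row/sorted_beta_of_profile.
move=> x; rewrite mem_row // mem_rev mem_iota.
apply/andP/idP => [[x_row]|x_right].
  by rewrite (mem_beta_of_profile _ x_row) //; lia.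
have x_row : k * T <= x < k.+1 * T.
  by move: x_right; rewrite !mulSn !mulnDr (mulnC k p); lia.
split; rewrite // (mem_beta_of_profile _ x_row) //.
by move: x_right; rewrite mulSn; lia.
Qed.

Lemma core_beta_of_profile m a :
  profile t p a -> core_beta_set ts (beta_of_profile m a).
Proof.
move=> [a0 aS]; split=> [||s].
- exact: sorted_beta_of_profile.
- by rewrite mem_filter /= div0n mul1n leqNgt a0.
rewrite mem_iota => s_ts x x_X le_sx.
have /andP[lt_km x_row] : (x %/ T < m) && (x %/ T * T <= x < (x %/ T).+1 * T).
  move: x_X; rewrite mem_filter mem_rev mem_iota => /andP[_ /andP[_ lt_x]].
  by rewrite ltn_divLR // lt_x leq_divM ltn_ceil.
case: (x %/ T) => [|k] in lt_km x_row.
  by rewrite (mem_beta_of_profile _ x_row) // in x_X; lia.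
rewrite (mem_beta_of_profile _ x_row) // in x_X.
rewrite (@mem_beta_of_profile m a _ k) ?(ltnW lt_km) //; have := aS k;
  by rewrite !mulSn in x_X x_row *; lia.
Qed.

Definition core_of_profile (m : nat) (a : nat -> nat) : seq nat :=
  partition_of_beta (beta_of_profile m a).

Lemma beta_set_core_of_profile m a : profile t p a ->
  beta_set (core_of_profile m a) = beta_of_profile m a.
Proof.
by case/(core_beta_of_profile m) => sorted_X _ _; apply: partition_of_betaK.
Qed.

Lemma is_core_partition_iotaP la :
  is_core_partition ts la <-> core_beta_set ts (beta_set la).
Proof. by apply: is_core_partition_beta_set; rewrite mem_iota leqNgt t_gt0. Qed.

Lemma is_core_partition_of_profile m a : profile t p a ->
  is_core_partition ts (core_of_profile m a).
Proof.
move=> prof_a; apply/is_core_partition_iotaP.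
by rewrite beta_set_core_of_profile //; apply: core_beta_of_profile.
Qed.

Lemma sumn_core_of_profile m a : t <= p * m -> profile t p a ->
  ((sumn (core_of_profile m a))%:Z = profile_size t m a)%R.
Proof.
move=> le_t prof_a.
have /is_core_partition_iotaP core_la := is_core_partition_of_profile m prof_a.
have := leif_sumn_core le_t core_la.
rewrite beta_set_core_of_profile //= => leif_la.
have sizeE k : k < m -> row_sizes (beta_of_profile m a) k = a k.
  by move=> lt_km; rewrite /row_sizes row_beta_of_profile // size_right_row.
rewrite (eq_profile_size t sizeE) in leif_la; apply/eqP; rewrite leif_la.
by apply/forallP => k; rewrite sizeE ?row_beta_of_profile.
Qed.

Lemma core_staircase_or_lt m la :
    0 < p -> t <= p * m -> is_core_partition ts la ->
  exists2 c, c < t & la = core_of_profile m (staircase p c)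
    \/ ((sumn la)%:Z < profile_size t m (staircase p c))%R.
Proof.
move=> p_gt0 le_t /is_core_partition_iotaP core_la.
have /= leif_la := leif_sumn_core le_t core_la.
have prof_la := profile_row_sizes core_la.
have [eq_a|[c lt_ct lt_size]] :=
    profile_staircase_or_lt m p_gt0 prof_la; last first.
  by exists c => //; right; apply: le_lt_trans leif_la lt_size.
have [lt_ct _] := prof_la; have prof_c := profile_staircase p lt_ct.
exists (row_sizes (beta_set la) 0) => //.
rewrite (eq_profile_size t eq_a) in leif_la.
have := lt_leif leif_la; case: forallP => [right_rows _|_ lt_size]; last first.
  by right; rewrite lt_size.
left; apply: beta_set_inj; rewrite beta_set_core_of_profile //.
apply: (core_beta_set_eq_rows le_t) => // [|k lt_km].
  exact: core_beta_of_profile.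
rewrite row_beta_of_profile // -eq_a //.
exact/eqP/(right_rows (Ordinal lt_km)).
Qed.

End IntervalCores.

Lemma staircaseS p q r k : r < p ->
  staircase p (p * q + r).+1 k = staircase p (p * q + r) k + (k < q.+1).
Proof.
move=> lt_rp; rewrite /staircase ltnS; case: leqP => [le_kq|lt_qk].
  by have := leq_mul (leqnn p) le_kq; lia.
by have := leq_mul (leqnn p) lt_qk; rewrite mulnS; lia.
Qed.

Lemma staircase_eq0 p q r k : r <= p -> q < k -> staircase p (p * q + r) k = 0.
Proof.
rewrite /staircase => le_rp lt_qk.
by have := leq_mul (leqnn p) lt_qk; rewrite mulnS; lia.
Qed.

Lemma sum_staircase p m q r : r <= p -> q < m ->
  \sum_(k < m) staircase p (p * q + r) k = p * 'C(q.+1, 2) + q.+1 * r.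
Proof.
move=> le_rp; elim: q m => [|q IH] [|m] // lt_qm; rewrite big_ord_recl /=.
  rewrite big1 => [|k _]; last exact: staircase_eq0.
  by rewrite bin_small // /staircase; lia.
have shift k : staircase p (p * q.+1 + r) k.+1 = staircase p (p * q + r) k.
  by rewrite /staircase !mulnS; lia.
under eq_bigr do rewrite /bump /= shift.
by rewrite IH // (binS q.+1) bin1 /staircase; lia.
Qed.

Lemma sum_succ_bin2 m : \sum_(k < m) k.+1 = 'C(m.+1, 2).
Proof. by rewrite -bin2_sum big_mkord big_ord_recl. Qed.

Lemma staircase_size_succ t m p q r : r < p -> q < m ->
  (profile_size t m (staircase p (p * q + r).+1)
  = profile_size t m (staircase p (p * q + r))
    + 'C(q + 2, 2)%:Z * (t%:Z - p%:Z * q%:Z - 2 * r%:Z - 1))%R.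
Proof.
move=> lt_rp lt_qm; have le_qm : q.+1 <= m by [].
rewrite (eq_profile_size t (fun k _ => staircaseS q k lt_rp)).
set a := staircase p (p * q + r).
have /= -> := profile_size_addb t m a (fun k => k < q.+1).
rewrite -(big_ord_widen m (fun=> 1)) //.
rewrite -(big_ord_widen m (fun k => k.+1 * t)) //.
rewrite -(big_ord_widen m (fun k => (a k).+1)) //.
have -> : \sum_(k < q.+1) (a k).+1 = p * 'C(q.+1, 2) + q.+1 * r + q.+1.
  under eq_bigr do rewrite -addn1.
  by rewrite big_split /= sum_staircase ?(ltnW lt_rp) // sum1_card card_ord.
rewrite sum_staircase ?(ltnW lt_rp) // sum1_card card_ord.
rewrite -big_distrl /= sum_succ_bin2 addn2 binS bin1.
by have := mul_bin_left q.+1 1; rewrite bin1 subn1 /=; nia.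
Qed.

Lemma staircase_sizeE t m p q r : r <= p -> q < m ->
  (profile_size t m (staircase p (p * q + r))
   = profile_size t m (staircase p (p * q))
     + 'C(q + 2, 2)%:Z * (r%:Z * (t%:Z - p%:Z * q%:Z - r%:Z)))%R.
Proof.
move=> + lt_qm; elim: r => [|r IH] lt_rp.
  by rewrite addn0 mul0r mulr0 addr0.
by rewrite addnS staircase_size_succ // IH ?(ltnW lt_rp) // intS; ring.
Qed.

Definition block_base (t p q : nat) : int :=
  ('C(q + 2, 3)%:Z * (p%:Z * (t%:Z - p%:Z))
   - 3 * 'C(q + 2, 4)%:Z * p%:Z ^+ 2)%R.

Lemma staircase_size_mul t m p q : q <= m ->
  profile_size t m (staircase p (p * q)) = block_base t p q.
Proof.
rewrite /block_base; elim: q => [|q IH] lt_qm.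
  have staircase0 k : staircase p (p * 0) k = 0 by rewrite /staircase muln0.
  rewrite (eq_profile_size t (fun k _ => staircase0 k)) /profile_size.
  by rewrite !big1 ?bin_small //; ring.
rewrite mulnS addnC staircase_sizeE // IH ?(ltnW lt_qm) //.
rewrite addSn !(binS (q + 2)) !PoszD.
have : 3 * 'C(q + 2, 3) = q * 'C(q + 2, 2) by rewrite mul_bin_left addnK.
by nia.
Qed.

Lemma leqif_mul_half r w : r <= w ->
  r * (w - r) <= w./2 * uphalf w ?= iff (r == w./2) || (r == uphalf w).
Proof.
move=> le_rw; rewrite uphalf_half; have := odd_double_half w.
move: (w./2) (odd w) => h [] /= def_w.
  by apply/leqifP; case: ifP => [/orP[]/eqP->|]; nia.
by apply/leqifP; case: ifP => [/orP[]/eqP->|]; nia.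
Qed.

Definition block_max (t p q : nat) : int :=
  ('C(q + 2, 2)%:Z * ((t - p * q)./2 * uphalf (t - p * q))%N%:Z
   + block_base t p q)%R.

Definition block_argmax (t p q : nat) : seq nat :=
  [:: p * q + (t - p * q)./2; p * q + uphalf (t - p * q)].

Lemma staircase_size_leif t m p q r : r <= p -> q < m -> p * q + r <= t ->
  (profile_size t m (staircase p (p * q + r)) <= block_max t p q
    ?= iff (p * q + r \in block_argmax t p q)%N)%R.
Proof.
move=> le_rp lt_qm le_t; have le_rw : r <= t - p * q by lia.
have [le_mul eq_mul] := leqif_mul_half le_rw.
have bin_gt0 : (0 < 'C(q + 2, 2)%:Z)%R by rewrite ltz_nat bin_gt0 leq_addl.
rewrite staircase_sizeE // staircase_size_mul ?(ltnW lt_qm) // addrC.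
rewrite (_ : (_ * (_ - _ - _) = (r * (t - p * q - r))%N%:Z)%R); last first.
  by rewrite PoszM; congr (_ * _)%R; lia.
rewrite !inE !eqn_add2l -eq_mul /block_max.
split; first by rewrite lerD2r ler_pM2l.
by rewrite (inj_eq (addIr _)) (inj_eq (mulfI (lt0r_neq0 bin_gt0))) eqz_nat.
Qed.

Lemma staircase_size_homo t m p q : q <= m -> p * q.+1 <= t ->
  {in [pred c | c <= p * q] &,
    {homo (fun c => profile_size t m (staircase p c)) :
       c c' / c < c' >-> (c < c')%R}}.
Proof.
move=> le_qm le_t; apply: homo_ltn_in; first exact: lt_trans.
  by move=> i j _ le_j k /andP[_ lt_kj]; apply: leq_trans (ltnW lt_kj) le_j.
move=> c _; rewrite inE => lt_c; have p_gt0 : 0 < p by case: p lt_c {le_t}.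
have lt_cq : c %/ p < q by rewrite ltn_divLR // mulnC.
have lt_r := ltn_pmod c p_gt0.
rewrite [c](divn_eq c p) mulnC; move: lt_cq lt_r {lt_c}.
move: (c %/ p) (c %% p) => i r lt_iq lt_rp.
rewrite staircase_size_succ ?(leq_trans lt_iq) // ltrDl.
rewrite mulr_gt0 ?ltz_nat ?bin_gt0 ?leq_addl //.
by have := leq_mul (leqnn p) lt_iq; rewrite !mulnS in le_t *; lia.
Qed.

Lemma max_size1E p n d : max_size1 p n d = block_max (p * n + d) p n.
Proof.
rewrite /max_size1 /block_max /block_base addKn divn2 PoszM.
have -> : (d%:Z - d./2%:Z = (uphalf d)%:Z)%R by lia.
by rewrite PoszD PoszM; ring.
Qed.

Lemma max_size2E p n d : d <= p ->
  max_size2 p n.+1 d = block_max (p * n.+1 + d) p n.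
Proof.
move=> le_dp; rewrite /max_size2 /block_max /block_base.
rewrite mulnS addnAC addnK divn2 PoszM !addSnnS.
have -> : (p%:Z - (p - d)./2%:Z = (uphalf (p + d))%:Z)%R by lia.
have -> : (d%:Z + (p - d)./2%:Z = (p + d)./2%:Z)%R by lia.
by rewrite !PoszD PoszM intS; ring.
Qed.

Lemma block_max0_ge0 t p : (0 <= block_max t p 0)%R.
Proof.
rewrite /block_max /block_base (@bin_small _ 3) // (@bin_small _ 4) //.
by rewrite !mul0r subrr addr0.
Qed.

Section MaximalCores.

Variables t p n : nat.
Hypothesis t_range : p * n < t <= p * n.+1.
Local Notation staircase_size c := (profile_size t n.+1 (staircase p c)).
Local Notation staircase_core c := (core_of_profile t p n.+1 (staircase p c)).

Let lt_t : p * n < t. Proof. by case/andP: t_range. Qed.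
Let le_t : t <= p * n.+1. Proof. by case/andP: t_range. Qed.
Let t_gt0 : 0 < t. Proof. exact: leq_ltn_trans lt_t. Qed.
Let p_gt0 : 0 < p. Proof. by have := leq_trans t_gt0 le_t; case: p. Qed.

(* For n = 0 the two blocks coincide. *)
Definition max_core_size : int :=
  Num.max (block_max t p n) (block_max t p n.-1).

Definition staircase_argmax : seq nat :=
  block_argmax t p n ++ block_argmax t p n.-1.

Lemma block_max_le q :
  q \in [:: n; n.-1] -> (block_max t p q <= max_core_size)%R.
Proof. by rewrite !inE le_max => /orP[]/eqP->; rewrite lexx ?orbT. Qed.

Lemma staircase_size_lt_max c : c < p * n.-1 ->
  (staircase_size c < max_core_size)%R.
Proof.
move=> lt_c; have n_gt0 : 0 < n by case: n lt_c => //; rewrite muln0.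
have lt_q : n.-1 < n.+1 by lia.
have le_pn : p * n.-1.+1 <= t by rewrite prednK // ltnW.
have homo_size := @staircase_size_homo t n.+1 p n.-1 (ltnW lt_q) le_pn.
have := homo_size c (p * n.-1); rewrite !inE leqnn (ltnW lt_c) lt_c.
move=> /(_ isT isT isT)/lt_le_trans; apply.
apply: le_trans (block_max_le (mem_last n [:: n.-1])).
have le_t0 : p * n.-1 + 0 <= t by move: le_pn; rewrite mulnS; lia.
by have [] := staircase_size_leif (leq0n p) lt_q le_t0; rewrite addn0.
Qed.

Lemma staircase_size_le_max c : c < t ->
  (staircase_size c <= max_core_size)%R
  /\ (staircase_size c = max_core_size -> c \in staircase_argmax).
Proof.
move=> lt_ct; have [/staircase_size_lt_max lt_c|le_c] := ltnP c (p * n.-1).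
  by split; [exact: ltW | move/eqP; rewrite lt_eqF].
have lt_cn : c %/ p < n.+1 by rewrite ltn_divLR // mulnC (leq_trans lt_ct).
have block_c : c %/ p \in [:: n; n.-1].
  by move: le_c; rewrite mulnC -leq_divRL // !inE; lia.
have def_c : c = p * (c %/ p) + c %% p by rewrite mulnC -divn_eq.
have [] := @staircase_size_leif t n.+1 p (c %/ p) (c %% p).
- exact/ltnW/ltn_pmod.
- exact: lt_cn.
- by rewrite -def_c ltnW.
rewrite -def_c => le_block eq_block; have le_max_c := block_max_le block_c.
split=> [|eq_max]; first exact: le_trans le_block le_max_c.
have : c \in block_argmax t p (c %/ p).
  by rewrite -eq_block eq_le le_block eq_max.
rewrite mem_cat; move: block_c; rewrite !inE.
by case/orP=> /eqP-> ->; rewrite ?orbT.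
Qed.

Lemma staircase_size_max_attained :
  exists2 c, c < t & staircase_size c = max_core_size.
Proof.
have attained q : q < n.+1 -> p * q < t -> t - p * q <= 2 * p ->
    exists2 c, c < t & staircase_size c = block_max t p q.
  move=> lt_qn lt_pq le_w; exists (p * q + (t - p * q)./2); first by lia.
  by apply/eqP; rewrite (staircase_size_leif _ lt_qn) ?mem_head //; lia.
rewrite /max_core_size; case: leP => _; apply: attained => //.
- by rewrite ltnS leq_pred.
- by apply: leq_ltn_trans lt_t; rewrite leq_mul2l leq_pred orbT.
- by move: le_t; case: n => [|i] /=; rewrite !mulnS; lia.
- by move: le_t; rewrite mulnS; lia.
Qed.

Lemma core_size_le_max la : is_core_partition (iota t p.+1) la ->
  ((sumn la)%:Z <= max_core_size)%R
  /\ ((sumn la)%:Z%R = max_core_size ->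
      exists2 c, c \in staircase_argmax & c < t /\ la = staircase_core c).
Proof.
move=> /(core_staircase_or_lt t_gt0 p_gt0 le_t)[c lt_ct].
have [le_max_c argmax_c] := staircase_size_le_max lt_ct.
case=> [->|/lt_le_trans/(_ le_max_c) lt_max].
  rewrite sumn_core_of_profile //; last exact: profile_staircase.
  by split=> // /argmax_c c_argmax; exists c.
by split; [exact: ltW | move/eqP; rewrite lt_eqF].
Qed.

Lemma staircase_core_partition c : c < t ->
  is_core_partition (iota t p.+1) (staircase_core c)
  /\ (sumn (staircase_core c))%:Z%R = staircase_size c.
Proof.
move=> /(profile_staircase p) prof_c.
by split; [apply: is_core_partition_of_profile | apply: sumn_core_of_profile].
Qed.

Lemma core_size_max_attained :
  exists2 la, is_core_partition (iota t p.+1) la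
    & (sumn la)%:Z%R = max_core_size.
Proof.
have [c lt_ct <-] := staircase_size_max_attained.
have [core_c size_c] := staircase_core_partition lt_ct.
by exists (staircase_core c).
Qed.

Definition maximal_cores : seq (seq nat) :=
  undup [seq staircase_core c | c <- staircase_argmax
          & (c < t) && (staircase_size c == max_core_size)].

Lemma mem_maximal_cores la : la \in maximal_cores <->
  is_core_partition (iota t p.+1) la /\ (sumn la)%:Z%R = max_core_size.
Proof.
rewrite mem_undup; split=> [/mapP[c]|[core_la size_la]].
  rewrite mem_filter => /andP[/andP[lt_ct /eqP <-] _] ->.
  exact: staircase_core_partition.
have [_ /(_ size_la)[c c_argmax [lt_ct def_la]]] := core_size_le_max core_la.
apply/mapP; exists c => //; rewrite mem_filter lt_ct c_argmax andbT /=.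
by have [_ <-] := staircase_core_partition lt_ct; rewrite -def_la size_la.
Qed.

Lemma size_maximal_cores : size maximal_cores <= 4.
Proof.
by rewrite (leq_trans (size_undup _)) // size_map size_filter count_size.
Qed.

End MaximalCores.

Lemma max_sizeE p n d : d <= p ->
  Num.max (max_size1 p n d) (max_size2 p n d) = max_core_size (p * n + d) p n.
Proof.
rewrite /max_core_size max_size1E; case: n => [|n] le_dp /=.
  rewrite maxxx; apply/max_idPl.
  have -> : max_size2 p 0 d = 0%R by rewrite /max_size2 !bin_small //; ring.
  exact: block_max0_ge0.
by rewrite max_size2E.
Qed.

Theorem theorem1p1 (t p n d : nat) (t_gt0 : 0 < t) (p_gt0 : 0 < p)
    (d_gt0 : 1 <= d) (d_le_p : d <= p) (def_t : t = p * n + d) :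
  let ts := iota t p.+1 in
  let M : int := Num.max (max_size1 p n d) (max_size2 p n d) in
  [/\ exists2 la : seq nat, is_core_partition ts la & Posz (sumn la) = M,
      forall la : seq nat, is_core_partition ts la -> (Posz (sumn la) <= M)%R
    & exists s : seq (seq nat),
        [/\ uniq s,
            forall la : seq nat,
              la \in s <-> is_core_partition ts la /\ Posz (sumn la) = M
          & size s <= 4]].
Proof.
have t_range : p * n < t <= p * n.+1 by rewrite mulnS; lia.
move=> ts; rewrite max_sizeE // -def_t; split.
- exact: core_size_max_attained.
- by move=> la /(core_size_le_max t_range)[].
exists (maximal_cores t p n); split.
- exact: undup_uniq.
- exact: mem_maximal_cores.
- exact: size_maximal_cores.
Qed.
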